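(* Let $\mu\in\mathcal T$ be an inner node. The association $$\phi\longmapsto t_\mu(\phi):=\big[\,[\mu;\,\phi,\gamma]\,\big]_{\mathrm{tan}},\qquad \gamma\in\Lambda\infty,\ \gamma>\mu(\phi),$$ is independent of the choice of $\gamma$, and so it defines a mapping $t_\mu\colon\mathrm{KP}(\mu)\to\mathrm{TD}(\mu)$, which induces a bijection between $\mathrm{KP}(\mu)/\!\sim_\mu$ and $\mathrm{TD}(\mu)$.
   Context: $(K,v)$ is a valued field, $\Gamma=v(K^* )$, and $\Gamma\hookrightarrow\Lambda$ is a fixed extension of ordered abelian groups; $\Lambda\infty=\Lambda\cup\{\infty\}$. $\mathcal T$ is the set of all valuations $\mu\colon K[x]\to\Lambda\infty$ (that is, $\mu(1)=0$, $\mu(0)=\infty$, $\mu(ab)=\mu(a)+\mu(b)$, $\mu(a+b)\ge\min\{\mu(a),\mu(b)\}$; nontrivial support $\mu^{-1}(\infty)$ is allowed) whose restriction to $K$ is $v$, ordered by $\mu\le\nu\iff\mu(f)\le\nu(f)$ for all $f$. All sets $\{\rho\in\mathcal T\mid\rho\le\mu\}$ are totally ordered. $\Gamma_\mu$ denotes the value group of $\mu$. Maximal elements of $\mathcal T$ are leaves, the others are inner nodes. Key polynomials. For $\mu\in\mathcal T$ and $\alpha\in\Gamma_\mu$ let $\mathcal P_\alpha=\{g\mid\mu(g)\ge\alpha\}$, $\mathcal P_\alpha^+=\{g\mid\mu(g)>\alpha\}$, $\mathcal G_\mu=\bigoplus_{\alpha\in\Gamma_\mu}\mathcal P_\alpha/\mathcal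 P_\alpha^+$; $\mathrm{in}_\mu g=g+\mathcal P^+_{\mu(g)}$ if $\mu(g)<\infty$ and $\mathrm{in}_\mu g=0$ otherwise. Write $g\sim_\mu h$ if $\mathrm{in}_\mu g=\mathrm{in}_\mu h$, and $h\mid_\mu g$ if $\mathrm{in}_\mu h$ divides $\mathrm{in}_\mu g$ in $\mathcal G_\mu$. $g$ is $\mu$-irreducible if $(\mathrm{in}_\mu g)\mathcal G_\mu$ is a nonzero prime ideal, and $\mu$-minimal if $g\nmid_\mu f$ for all nonzero $f$ with $\deg f<\deg g$. $\mathrm{KP}(\mu)$ is the set of monic polynomials that are both $\mu$-minimal and $\mu$-irreducible (key polynomials); $\mu$ is inner iff $\mathrm{KP}(\mu)\ne\emptyset$. For $\phi\in\mathrm{KP}(\mu)$ and $\gamma\in\Lambda\infty$ with $\gamma>\mu(\phi)$, the augmented valuation $\nu=[\mu;\phi,\gamma]\in\mathcal T$ is defined on $\phi$-expansions $f=\sum_s a_s\phi^s$, $\deg(a_s)<\deg(\phi)$, by $\nu(f)=\min_s\{\mu(a_s)+s\gamma\}$; it satisfies $\mu<\nu$. Tangent directions. For an inner node $\mu$, $\mathrm{TD}(\mu)=\{\nu\in\mathcal T\mid\mu<\nu\}/\!\sim_{\mathrm{tan}}$, where $\nu\sim_{\mathrm{tan}}\nu'$ iff $(\mu,\nu]\cap(\mu,\nu']\ne\emptyset$, with $(\mu,\nu]=\{\rho\in\mathcal T\mid\mu<\rho\le\nu\}$. This is an equivalence relation; $[\nu]_{\mathrm{tan}}$ is the class of $\nu$.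 *)

(* Defs.v *)
From HB Require Import structures.
From mathcomp Require Import all_boot all_order all_algebra ring_quotient.
From mathcomp Require Import finmap.
From mathcomp Require Import boolp classical_sets functions.

Set Implicit Arguments.
Unset Strict Implicit.
Unset Printing Implicit Defensive.

Import Order.TTheory GRing.Theory.
Local Open Scope ring_scope.

(* The library's [porderZmodType] relates its order and its addition by no
   axiom; its order is partial. *)
HB.mixin Record POrderedZmodule_isOrderedAbelianGroup L
    of Num.POrderedZmodule L := {
  oag_total : total (<=%R : rel L);
  oag_leD2l : forall z x y : L, x <= y -> z + x <= z + y
}.

#[short(type="oagType")]
HB.structure Definition OrderedAbelianGroup :=
  { L of Num.POrderedZmodule L & POrderedZmodule_isOrderedAbelianGroup L }.

Inductive ext (L : Type) : Type := Fin of L | Infty.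
Arguments Infty {L}.

Definition ext_map (L M : Type) (f : L -> M) (a : ext L) : ext M :=
  if a is Fin x then Fin (f x) else Infty.

Section ExtChoice.
Context (L : Type).

Definition ext_opt (a : ext L) : option L := if a is Fin x then Some x else None.
Definition opt_ext (a : option L) : ext L := if a is Some x then Fin x else Infty.

Lemma ext_optK : cancel ext_opt opt_ext. Proof. by case. Qed.

End ExtChoice.

HB.instance Definition _ (L : choiceType) :=
  Choice.copy (ext L) (can_type (@ext_optK L)).

Section ExtOag.
Context (L : oagType).
Implicit Types a b c : ext L.

Definition ext_le a b : bool :=
  match a, b with
  | _, Infty => true
  | Infty, Fin _ => false
  | Fin x, Fin y => x <= y
  end.

Lemma ext_le_refl : reflexive ext_le. Proof. by case=> /=. Qed.

Lemma ext_le_anti : antisymmetric ext_le.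
Proof. by case=> [x|] [y|] //= /le_anti ->. Qed.

Lemma ext_le_trans : transitive ext_le.
Proof. by case=> [x|] [y|] [z|] //=; apply: le_trans. Qed.

Lemma ext_le_total : total ext_le.
Proof. by case=> [x|] [y|] //=; apply: oag_total. Qed.

HB.instance Definition _ :=
  Order.Le_isPOrder.Build ring_display (ext L)
    ext_le_refl ext_le_anti ext_le_trans.

HB.instance Definition _ :=
  Order.POrder_isTotal.Build ring_display (ext L) ext_le_total.

Definition ext_add a b : ext L :=
  if a is Fin x then if b is Fin y then Fin (x + y) else Infty else Infty.

Lemma ext_addA : associative ext_add.
Proof. by case=> [x|] [y|] [z|] //=; rewrite addrA. Qed.

Lemma ext_addC : commutative ext_add.
Proof. by case=> [x|] [y|] //=; rewrite addrC. Qed.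

Lemma ext_add0 : left_id (Fin 0) ext_add.
Proof. by case=> [x|] //=; rewrite add0r. Qed.

HB.instance Definition _ :=
  GRing.isNmodule.Build (ext L) ext_addA ext_addC ext_add0.

End ExtOag.

(* Valuations of a commutative ring; the support [v^-1(Infty)] may be
   nontrivial. *)
Record valuation (A : comNzRingType) (L : oagType) := Valuation {
  valuation_fun :> A -> ext L;
  valuation1 : valuation_fun 1 = 0;
  valuation0 : valuation_fun 0 = Infty;
  valuationM : forall a b,
    valuation_fun (a * b) = valuation_fun a + valuation_fun b;
  valuationD : forall a b,
    Order.min (valuation_fun a) (valuation_fun b) <= valuation_fun (a + b)
}.

Lemma valuation_ext (A : comNzRingType) (L : oagType) (v w : valuation A L) :
  v =1 w -> v = w.
Proof.
case: v w => [f f1 f0 fM fD] [g g1 g0 gM gD] /= /funext fg.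
by case: g / fg in g1 g0 gM gD *; congr Valuation; apply: Prop_irrelevance.
Qed.

(* The group algebra A[L]: finitely supported functions with convolution. *)
Section GroupAlgebra.
Context (A : comNzRingType) (L : zmodType).
Local Open Scope fset_scope.
Local Open Scope ring_scope.

Definition galg := {fsfun L -> A with 0}.
HB.instance Definition _ := Choice.on galg.

Implicit Types (f g h : galg) (x y z : L).

Definition galg0 : galg := [fsfun].
Definition galg_opp f : galg := [fsfun x in finsupp f => - f x].
Definition galg_add f g : galg :=
  [fsfun x in finsupp f `|` finsupp g => f x + g x].
Definition galg_mono x (a : A) : galg := [fsfun y in [fset x] => a].
Definition galg_mul f g : galg :=
  [fsfun z in [fset x + y | x in finsupp f, y in finsupp g] =>
     \sum_(x <- finsupp f) f x * g (z - x)].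

Lemma galg0E x : galg0 x = 0.
Proof. by rewrite fsfun0E. Qed.

Lemma galg_oppE f x : galg_opp f x = - f x.
Proof. by rewrite fsfunE; case: finsuppP; rewrite ?oppr0. Qed.

Lemma galg_addE f g x : galg_add f g x = f x + g x.
Proof.
by rewrite fsfunE inE; do 2 case: finsuppP => ? //=; rewrite ?addr0.
Qed.

Lemma galg_monoE x a y : galg_mono x a y = if y == x then a else 0.
Proof. by rewrite fsfunE inE. Qed.

Lemma galg_mulE_sub f g z (S : {fset L}) : finsupp f `<=` S ->
  galg_mul f g z = \sum_(x <- S) f x * g (z - x).
Proof.
move=> sfS.
have <- : \sum_(x <- finsupp f) f x * g (z - x) = \sum_(x <- S) f x * g (z - x).
  by apply: big_fset_incl => // x _ /fsfun_dflt->; rewrite mul0r.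
rewrite fsfunE; case: ifPn => // zN; rewrite big_seq big1 // => x xf.
have [yg|/fsfun_dflt->] := boolP (z - x \in finsupp g); last by rewrite mulr0.
case/negP: zN; apply/imfset2P; exists x => //; exists (z - x) => //.
by rewrite addrC subrK.
Qed.

Lemma galg_mulE f g z :
  galg_mul f g z = \sum_(x <- finsupp f) f x * g (z - x).
Proof. exact: galg_mulE_sub. Qed.

Lemma galg_addA : associative galg_add.
Proof. by move=> f g h; apply/fsfunP => x; rewrite !galg_addE addrA. Qed.
Lemma galg_addC : commutative galg_add.
Proof. by move=> f g; apply/fsfunP => x; rewrite !galg_addE addrC. Qed.
Lemma galg_add0 : left_id galg0 galg_add.
Proof. by move=> f; apply/fsfunP => x; rewrite !galg_addE galg0E add0r. Qed.
Lemma galg_addN : left_inverse galg0 galg_opp galg_add.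
Proof.
by move=> f; apply/fsfunP => x; rewrite !galg_addE galg_oppE galg0E addNr.
Qed.

HB.instance Definition _ :=
  GRing.isZmodule.Build galg galg_addA galg_addC galg_add0 galg_addN.

Lemma galg_mulC : commutative galg_mul.
Proof.
move=> f g; apply/fsfunP => z.
pose S := finsupp f `|` [fset z - y | y in finsupp g].
rewrite (@galg_mulE_sub f g z S) ?fsubsetUl // galg_mulE.
transitivity (\sum_(x <- [fset z - y | y in finsupp g]) f x * g (z - x)).
  apply/esym/big_fset_incl; first exact: fsubsetUr.
  move=> x _ xN; have [zx|/fsfun_dflt->] := boolP (z - x \in finsupp g);
    last by rewrite mulr0.
  by case/negP: xN; apply/imfsetP; exists (z - x) => //; rewrite subKr.
rewrite big_imfset /=; last by move=> x y _ _ /addrI/oppr_inj.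
by apply: eq_bigr => y _; rewrite subKr mulrC.
Qed.

Lemma galg_mulA : associative galg_mul.
Proof.
move=> f g h; apply/fsfunP => z; rewrite galg_mulE.
pose S := [fset x + y | x in finsupp f, y in finsupp g].
rewrite (@galg_mulE_sub _ h z S); last first.
  by apply/fsubsetP => x; rewrite mem_finsupp fsfunE; case: ifP; rewrite ?eqxx.
under [RHS]eq_bigr do rewrite galg_mulE mulr_suml.
rewrite exchange_big /= !big_seq; apply: eq_bigr => x xf.
rewrite galg_mulE mulr_sumr.
transitivity (\sum_(w <- [fset x + y | y in finsupp g])
                f x * g (w - x) * h (z - w)).
  rewrite big_imfset /=; last by move=> y y' _ _ /addrI.
  by apply: eq_bigr => y _; rewrite [x + y]addrC addrK [y + x]addrC opprD addrA mulrA.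
apply: big_fset_incl.
  apply/fsubsetP => w /imfsetP[y /= yg ->].
  by apply/imfset2P; exists x => //; exists y.
move=> w _ wN; have [yg|/fsfun_dflt->] := boolP (w - x \in finsupp g);
  last by rewrite mulr0 mul0r.
by case/negP: wN; apply/imfsetP; exists (w - x) => //; rewrite addrC subrK.
Qed.

Lemma galg_mul1 : left_id (galg_mono 0 1) galg_mul.
Proof.
move=> f; apply/fsfunP => z.
rewrite (@galg_mulE_sub _ _ _ [fset 0]) ?big_seq_fset1; last exact: finsupp_sub.
by rewrite galg_monoE eqxx mul1r subr0.
Qed.

Lemma galg_mulDl : left_distributive galg_mul galg_add.
Proof.
move=> f g h; apply/fsfunP => z; rewrite galg_addE.
pose S := finsupp f `|` finsupp g.
rewrite !(@galg_mulE_sub _ _ _ S) ?fsubsetUl ?fsubsetUr ?finsupp_sub //.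
by rewrite -big_split /=; apply: eq_bigr => x _; rewrite galg_addE mulrDl.
Qed.

Lemma galg1_neq0 : galg_mono 0 1 != galg0.
Proof.
apply/eqP => /fsfunP/(_ 0); rewrite galg_monoE eqxx galg0E.
by move/eqP; rewrite oner_eq0.
Qed.

HB.instance Definition _ :=
  GRing.Zmodule_isComNzRing.Build galg galg_mulA galg_mulC galg_mul1
    galg_mulDl galg1_neq0.

End GroupAlgebra.

Section ExtTheory.
Context (L : oagType).
Implicit Types a b c : ext L.

Lemma ext_addE (x y : L) : Fin x + Fin y = Fin (x + y). Proof. by []. Qed.

Lemma ext_leD a b c d : a <= c -> b <= d -> a + b <= c + d.
Proof.
case: c d => [z|] [t|]; case: a b => [x|] [y|] //= h1 h2.
apply: (@le_trans _ _ (x + t)); first exact: oag_leD2l.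
by rewrite ![_ + t]addrC; apply: oag_leD2l.
Qed.

Lemma ext_ltD (x y : L) a b : Fin x < a -> Fin y <= b -> Fin (x + y) < a + b.
Proof.
move=> xa yb; rewrite lt_neqAle -ext_addE ext_leD ?andbT //; last exact: ltW.
case: a b xa yb => [z|] [t|] // xz yt; apply/eqP => -[e].
have zx : z <= x.
  rewrite -(addrK t z) -(addrK t x) ![_ - t]addrC; apply: oag_leD2l.
  by rewrite -e; apply: oag_leD2l.
by have := lt_le_trans xz (zx : Fin z <= Fin x); rewrite ltxx.
Qed.

End ExtTheory.

Section GradedAlgebra.
Context (K : fieldType) (L : oagType) (mu : valuation {poly K} L).

(* The value group is the one of the fraction field of K[x]/supp(mu), whence
   the differences of finite values. *)
Definition value_group : set L :=
  [set alpha | exists f g beta, mu f = Fin (alpha + beta) /\ mu g = Fin beta]%classic.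

Definition filt (alpha : L) : set {poly K} := [set g | Fin alpha <= mu g]%classic.
Definition filt_plus (alpha : L) : set {poly K} := [set g | Fin alpha < mu g]%classic.

(* The graded algebra is presented as the quotient of the subring
   (+)_(alpha in value_group) filt alpha of the group algebra of K[x] by its
   ideal (+)_(alpha in value_group) filt_plus alpha. *)
Definition filt_alg_pred (a : galg {poly K} L) : bool :=
  `[< forall alpha,
        filt alpha (a alpha) /\ (a alpha != 0 -> value_group alpha) >].

Lemma value_group0 : value_group 0.
Proof. by exists 1, 1, 0; rewrite addr0 valuation1. Qed.

Lemma value_groupD x y : value_group x -> value_group y -> value_group (x + y).
Proof.
move=> [f [g [b [fE gE]]]] [f' [g' [b' [fE' gE']]]].
exists (f * f'), (g * g'), (b + b').
by rewrite !valuationM fE gE fE' gE' !ext_addE addrACA.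
Qed.

Lemma filt0 alpha : filt alpha 0.
Proof. by rewrite /filt /= valuation0. Qed.

Lemma valuationN f : mu (- f) = mu f.
Proof.
have m1 : mu (-1) = 0.
  have : mu (-1) + mu (-1) = 0 by rewrite -valuationM mulrNN mulr1 valuation1.
  case: (mu (-1)) => [x|] // [e]; case: (ltgtP (Fin x) (Fin 0)) => // h.
    by have := ext_ltD h (ltW h); rewrite ext_addE e addr0 ltxx.
  by have := ext_ltD h (ltW h); rewrite ext_addE e addr0 ltxx.
by rewrite -mulN1r valuationM m1 add0r.
Qed.

Lemma filtB alpha f g : filt alpha f -> filt alpha g -> filt alpha (f - g).
Proof.
move=> hf hg; apply: (le_trans _ (valuationD mu _ _)).
by rewrite le_min valuationN; apply/andP.
Qed.

Lemma filt_plusD alpha f g :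
  filt_plus alpha f -> filt_plus alpha g -> filt_plus alpha (f + g).
Proof.
move=> hf hg; apply: (lt_le_trans _ (valuationD mu _ _)).
by rewrite lt_min; apply/andP.
Qed.

Lemma filtD alpha f g : filt alpha f -> filt alpha g -> filt alpha (f + g).
Proof.
move=> hf hg; apply: (le_trans _ (valuationD mu _ _)).
by rewrite le_min; apply/andP.
Qed.

Lemma filtM x y f g : filt x f -> filt y g -> filt (x + y) (f * g).
Proof. by rewrite /filt /= valuationM; exact: (@ext_leD _ (Fin x) (Fin y)). Qed.

Lemma filt_plusM x y f g :
  filt x f -> filt_plus y g -> filt_plus (x + y) (f * g).
Proof.
by move=> hf hg; rewrite /filt_plus /= valuationM addrC [mu f + _]addrC; apply: ext_ltD.
Qed.

Lemma filt_alg_subring : subring_closed filt_alg_pred.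
Proof.
split.
- apply/asboolP => al; rewrite galg_monoE; case: eqP => [->|_].
    split=> [|_]; last exact: value_group0.
    by rewrite /filt /= valuation1.
  by rewrite eqxx; split => //; exact: filt0.
- move=> a b /asboolP ha /asboolP hb; apply/asboolP => al.
  have [ha1 ha2] := ha al; have [hb1 hb2] := hb al.
  rewrite galg_addE galg_oppE; split; first exact: filtB.
  have [a0|/ha2//] := eqVneq (a al) 0.
  by rewrite a0 add0r oppr_eq0 => /hb2.
- move=> a b /asboolP ha /asboolP hb; apply/asboolP => al.
  rewrite galg_mulE; split.
    apply: big_ind => [||x _]; [exact: filt0 | exact: filtD |].
    by rewrite -{1}[al](subrK x) [_ + x]addrC; apply: filtM; [case: (ha x)|case: (hb (al - x))].
  apply: contra_neqP => alN; rewrite big_seq big1 // => x xa.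
  have [b0|bN0] := eqVneq (b (al - x)) 0; first by rewrite b0 mulr0.
  case: alN; rewrite -[al](subrK x); apply: value_groupD.
    exact: (hb (al - x)).2.
  by apply: (ha x).2; rewrite -mem_finsupp.
Qed.

HB.instance Definition _ :=
  GRing.isSubringClosed.Build _ filt_alg_pred filt_alg_subring.

Record filt_alg := FiltAlg { filt_alg_val :> galg {poly K} L;
                             _ : filt_alg_val \in filt_alg_pred }.
HB.instance Definition _ := [isSub for filt_alg_val].
HB.instance Definition _ := [Choice of filt_alg by <:].
HB.instance Definition _ := [SubChoice_isSubComNzRing of filt_alg by <:].

Definition filt_alg_plus (a : filt_alg) : bool :=
  `[< forall alpha, filt_plus alpha (filt_alg_val a alpha) >].

Lemma filt_alg_plus_ideal : idealr_closed filt_alg_plus.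
Proof.
split.
- apply/asboolP => al; rewrite (_ : filt_alg_val 0 = 0) ?galg0E //.
  by rewrite /filt_plus /= valuation0.
- apply/asboolP => /(_ 0); rewrite (_ : filt_alg_val 1 = 1) //.
  by rewrite galg_monoE eqxx /filt_plus /= valuation1 ltxx.
- move=> a u v /asboolP hu /asboolP hv; apply/asboolP => al.
  rewrite (_ : filt_alg_val _ = filt_alg_val a * filt_alg_val u + filt_alg_val v) //.
  rewrite galg_addE galg_mulE; apply: filt_plusD => //.
  apply: big_ind => [||x _]; [by rewrite /filt_plus /= valuation0 | exact: filt_plusD |].
  rewrite -{1}[al](subrK x) [_ + x]addrC; apply: filt_plusM => //.
  by case: (asboolP _ (valP a) x).
Qed.

HB.instance Definition _ := isIdealr.Build _ filt_alg_plus filt_alg_plus_ideal.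

Definition graded_ideal : idealr filt_alg := filt_alg_plus.

Definition graded_alg : comNzRingType := {ideal_quot graded_ideal}.

Definition graded_pi (a : filt_alg) : graded_alg := \pi_{ideal_quot graded_ideal}%qT a.

Lemma graded_pi_is_zmod_morphism : zmod_morphism graded_pi.
Proof. exact: (rmorphB (\pi_{ideal_quot graded_ideal}%qT)). Qed.
Lemma graded_pi_is_monoid_morphism : monoid_morphism graded_pi.
Proof.
split; first exact: (rmorph1 (\pi_{ideal_quot graded_ideal}%qT)).
exact: (rmorphM (\pi_{ideal_quot graded_ideal}%qT)).
Qed.
HB.instance Definition _ := GRing.isZmodMorphism.Build filt_alg graded_alg
  graded_pi graded_pi_is_zmod_morphism.
HB.instance Definition _ := GRing.isMonoidMorphism.Build filt_alg graded_alg
  graded_pi graded_pi_is_monoid_morphism.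

Lemma graded_pi_eq0 a : (graded_pi a == 0) = filt_alg_plus a.
Proof.
have <- : graded_pi 0 = 0 by exact: rmorph0.
have := Quotient.idealrBE graded_ideal a 0; rewrite subr0 => e.
by rewrite -[LHS]e.
Qed.

(* The initial form of g. [insubd] falls back to 0 outside of the subring,
   which does not occur: see [galg_mono_filt_alg]. *)
Definition init_form (g : {poly K}) : graded_alg :=
  if mu g is Fin alpha then graded_pi (insubd 0 (galg_mono alpha g)) else 0.

Lemma galg_mono_filt_alg g alpha :
  mu g = Fin alpha -> galg_mono alpha g \in filt_alg_pred.
Proof.
move=> gE; apply/asboolP => al; rewrite galg_monoE.
case: eqP => [->|_]; last by rewrite eqxx; split=> //; exact: filt0.
split=> [|_]; first by rewrite /filt /= gE.
by exists g, 1, 0; rewrite addr0 valuation1.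
Qed.

Definition mu_equiv (g h : {poly K}) : Prop := init_form g = init_form h.

Definition mu_divides (h g : {poly K}) : Prop := exists c, init_form g = c * init_form h.

Definition principal_ideal (x : graded_alg) : {pred graded_alg} :=
  [pred y | `[< exists c, y = c * x >]].

Definition mu_irreducible (g : {poly K}) : Prop :=
  [/\ init_form g != 0,
      idealr_closed (principal_ideal (init_form g))
    & prime_idealr_closed (principal_ideal (init_form g))].

Definition mu_minimal (g : {poly K}) : Prop :=
  forall f : {poly K}, f != 0 -> (size f < size g)%N -> ~ mu_divides g f.

Definition KP : set {poly K} :=
  [set phi | [/\ phi \is monic, mu_minimal phi & mu_irreducible phi]]%classic.

Definition KP_class (phi : {poly K}) : set {poly K} :=
  [set psi | KP psi /\ mu_equiv phi psi]%classic.

Definition KP_quotient : set (set {poly K}) := (KP_class @` KP)%classic.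

End GradedAlgebra.

Section Tree.
Context (K : fieldType) (Gamma Lambda : oagType).
Context (v : valuation K Gamma) (iota : Gamma -> Lambda).

(* The tree T of the extensions of v to valuations of K[x]. *)
Record node := Node {
  node_val :> valuation {poly K} Lambda;
  node_res : forall c : K, node_val c%:P = ext_map iota (v c)
}.

Lemma node_eqP (mu nu : node) : mu =1 nu -> mu = nu.
Proof.
case: mu nu => [m mv] [n nv] /= /valuation_ext mn.
by case: n / mn in nv *; congr Node; apply: Prop_irrelevance.
Qed.

HB.instance Definition _ := gen_eqMixin node.
HB.instance Definition _ := gen_choiceMixin node.

Definition node_le (mu nu : node) : bool := `[< forall f, mu f <= nu f >].

Lemma node_le_refl : reflexive node_le.
Proof. by move=> mu; apply/asboolP. Qed.

Lemma node_le_anti : antisymmetric node_le.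
Proof.
move=> mu nu /andP[/asboolP h1 /asboolP h2].
by apply: node_eqP => f; apply/le_anti/andP.
Qed.

Lemma node_le_trans : transitive node_le.
Proof.
move=> nu mu rho /asboolP h1 /asboolP h2.
by apply/asboolP => f; apply: le_trans (h1 f) (h2 f).
Qed.

HB.instance Definition _ :=
  Order.Le_isPOrder.Build (Order.Disp tt tt) node
    node_le_refl node_le_anti node_le_trans.

Local Open Scope classical_set_scope.
Implicit Types mu nu : node.

Definition inner_node mu : Prop := exists nu, (mu < nu)%O.

(* The valuation nu is [mu; phi, gamma]. *)
Definition is_augmentation mu (phi : {poly K}) (gamma : ext Lambda) nu : Prop :=
  forall (n : nat) (a : nat -> {poly K}),
    (forall s, (s < n)%N -> (size (a s) < size phi)%N) ->
    nu (\sum_(s < n) a s * phi ^+ s)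
      = \big[Order.min/Infty]_(s < n) (mu (a s) + gamma *+ s).

Definition segment mu nu : set node := [set rho | (mu < rho <= nu)%O].

Definition tan_equiv mu nu nu' : Prop := segment mu nu `&` segment mu nu' !=set0.

Definition tan_class mu nu : set node :=
  [set nu' | (mu < nu')%O /\ tan_equiv mu nu nu'].

Definition TD mu : set (set node) := [set tan_class mu nu | nu in [set nu | (mu < nu)%O]].

End Tree.

(* Main.v *)
Require Import Defs.
From HB Require Import structures.
From mathcomp Require Import all_boot all_order all_algebra ring_quotient.
From mathcomp Require Import finmap.
From mathcomp Require Import boolp classical_sets functions.

Set Implicit Arguments.
Unset Strict Implicit.
Unset Printing Implicit Defensive.

Import Order.TTheory GRing.Theory.
Local Open Scope classical_set_scope.
Local Open Scope ring_scope.

(** For a valuation [nu] above [mu], consider the locus of the polynomials [f]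
    with [mu f < nu f]. Everything rests on three facts about it.

    - If [phi] is a key polynomial of [mu], the augmentation
      [[mu; phi, gamma]] exists, and its locus consists of the [f] with
      [mu f] finite which are divisible by [phi] with respect to [mu]
      ([lt_augP]); this does not involve [gamma]. The augmentation is computed
      along the [phi]-expansion. The only delicate axiom is multiplicativity
      ([augM]), proved by induction on degrees. If the value of [f] or of [g]
      is not attained at its remainder modulo [phi], the ultrametric equality
      reduces to a quotient. If both are attained there, the remainder of
      [f * g] is that of the product of the remainders, whose value is known
      because [phi] is minimal and irreducible ([KP_modM]).

    - If [nu > mu], a monic polynomial [phi] of minimal degree in the locus of
      [nu] is a key polynomial of [mu], and the locus consists of its
      multiples ([raised_min_KP], [raisedP]). Indeed the ideal generated by the
      initial form of [phi] is the kernel of the natural map from the graded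
      algebra of [mu] to that of [nu] ([principal_idealP]), and the
      latter is a domain because the group of values is totally ordered.

    - If [mu < rho <= nu], then [rho] and [nu] have the same locus
      ([raised_between]): the key polynomial attached to [nu] divides the one
      attached to [rho], whose initial form is prime.

    Hence two nodes above [mu] are tangent exactly if their loci are equal
    ([tan_equivP]); for the converse, an augmentation of [mu] with a small
    enough [gamma] lies below both. So the tangent direction of [phi] is the
    set of the nodes whose locus consists of the multiples of [phi]. Every
    direction arises in this way, and two key polynomials with the same
    multiples divide each other, have the same degree, and, being monic, are
    [mu]-equivalent ([KP_mutual_equiv]). *)

(** * Ordered groups extended by infinity *)

Section ExtArith.
Context (L : oagType).
Implicit Types (a b c d : ext L) (x y : L).

Lemma lex_infty a : a <= Infty.
Proof. by case: a. Qed.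

Lemma ltx_infty a : (a < Infty) = (a != Infty).
Proof. by rewrite lt_neqAle lex_infty andbT. Qed.

Lemma lt_finite a b : a < b -> a != Infty.
Proof. by move=> /lt_le_trans/(_ (lex_infty b)); rewrite ltx_infty. Qed.

Lemma extD_infty a b : (a + b == Infty) = (a == Infty) || (b == Infty).
Proof. by case: a b => [x|] [y|]. Qed.

Lemma extDy a : a + Infty = Infty.
Proof. by case: a. Qed.

Lemma ext_ltD2 a b c d : a < c -> b <= d -> b != Infty -> a + b < c + d.
Proof.
case: a b => [x|] [y|] //; first by move=> xc yd _; apply: ext_ltD.
by rewrite ltNge lex_infty.
Qed.

Lemma extD_minr a b c : a + Order.min b c = Order.min (a + b) (a + c).
Proof.
have [bc|/ltW cb] := leP b c; first by rewrite (min_idPl _) // ext_leD.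
by rewrite (min_idPr _) // ext_leD.
Qed.

End ExtArith.

(** * Ultrametric inequalities *)

Section ValuationTheory.
Context (K : fieldType) (L : oagType) (w : valuation {poly K} L).
Implicit Types a b : {poly K}.

Lemma valD_ge c a b : c <= w a -> c <= w b -> c <= w (a + b).
Proof. by move=> ha hb; apply: le_trans (valuationD _ _ _); rewrite le_min ha. Qed.

Lemma valD_gt c a b : c < w a -> c < w b -> c < w (a + b).
Proof. by move=> ha hb; apply: lt_le_trans (valuationD _ _ _); rewrite lt_min ha. Qed.

(** Ultrametric equality. *)
Lemma valD_lt a b : w a < w b -> w (a + b) = w a.
Proof.
move=> ab; apply/le_anti/andP; split; last by apply: valD_ge => //; exact: ltW.
rewrite leNgt; apply/negP => h.
have := @valD_gt (w a) (a + b) (- b) h; rewrite valuationN addrK => /(_ ab).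
by rewrite ltxx.
Qed.

Lemma valB_eq a b : w a < w (a - b) -> w b = w a.
Proof.
by move=> h; rewrite -[b](subKr a) valD_lt // valuationN.
Qed.

End ValuationTheory.

(** * Initial forms *)

Section Graded.
Context (K : fieldType) (L : oagType) (mu : valuation {poly K} L).
Implicit Types (f g h : {poly K}) (x y : L) (a b : filt_alg mu).

(** The homogeneous element of degree [x] with component [g]. The default value
    0 is taken unless [g] has value at least [x] and [x] is in the value group:
    see [val_homog]. *)
Definition homog x g : filt_alg mu := insubd 0 (galg_mono x g).

Lemma val_homog x g : value_group mu x -> Fin x <= mu g ->
  val (homog x g) = galg_mono x g.
Proof.
move=> xG xg; rewrite insubdK //; apply/asboolP => y; rewrite galg_monoE.
by case: eqP => [->|_] //; rewrite eqxx; split=> //; exact: filt0.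
Qed.

Lemma value_group_val g x : mu g = Fin x -> value_group mu x.
Proof. by move=> gE; exists g, 1, 0; rewrite addr0 valuation1. Qed.

Lemma init_formE g x : mu g = Fin x -> init_form mu g = graded_pi (homog x g).
Proof. by rewrite /init_form => ->. Qed.

Lemma init_form_infty g : mu g = Infty -> init_form mu g = 0.
Proof. by rewrite /init_form => ->. Qed.

Lemma graded_pi_eq a b : graded_pi a = graded_pi b <->
  (forall x, Fin x < mu (val a x - val b x)).
Proof.
have -> : (graded_pi a = graded_pi b) <-> (filt_alg_plus (a - b)).
  rewrite -graded_pi_eq0 rmorphB subr_eq0.
  by split=> /eqP.
have E x : val (a - b) x = val a x - val b x.
  by rewrite raddfB /= galg_addE galg_oppE.
split=> [/asboolP h x|h]; first by rewrite -E; exact: h.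
by apply/asboolP => x; rewrite [filt_alg_val _ _]E; exact: h.
Qed.

(** The class of [homog x g] is the initial form of [g], unless the value of
    [g] exceeds [x]. *)
Lemma graded_pi_homog x g : value_group mu x -> Fin x <= mu g ->
  graded_pi (homog x g) = (if mu g == Fin x then init_form mu g else 0).
Proof.
move=> xG xg; case: eqP => [/init_formE -> //|/eqP ne].
rewrite -(rmorph0 (@graded_pi _ _ mu)); apply/graded_pi_eq => y.
rewrite val_homog // galg_monoE raddf0 galg0E subr0.
case: eqP => [->|_]; last by rewrite valuation0 ltx_infty.
by rewrite lt_neqAle eq_sym ne.
Qed.

Lemma init_form_eq0 g : init_form mu g = 0 <-> mu g = Infty.
Proof.
split=> [|/init_form_infty //]; case gE: (mu g) => [x|] //.
rewrite (init_formE gE) -(rmorph0 (@graded_pi _ _ mu)) => /graded_pi_eq/(_ x).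
rewrite val_homog ?gE //; last exact: value_group_val gE.
by rewrite galg_monoE eqxx raddf0 galg0E subr0 gE ltxx.
Qed.

Lemma init_form1 : init_form mu 1 = 1.
Proof.
rewrite (init_formE (valuation1 mu)) -(rmorph1 (@graded_pi _ _ mu)).
congr graded_pi; apply: val_inj; rewrite [LHS]val_homog ?valuation1 //.
exact: value_group0.
Qed.

Lemma init_formM f g : init_form mu (f * g) = init_form mu f * init_form mu g.
Proof.
case fE: (mu f) => [x|]; last first.
  by rewrite (init_form_infty fE) mul0r init_form_infty // valuationM fE.
case gE: (mu g) => [y|]; last first.
  by rewrite (init_form_infty gE) mulr0 init_form_infty // valuationM gE extDy.
have fgE : mu (f * g) = Fin (x + y) by rewrite valuationM fE gE.
rewrite (init_formE fE) (init_formE gE) (init_formE fgE) -rmorphM.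
congr graded_pi; apply: val_inj.
have ? := value_group_val fE; have ? := value_group_val gE.
have ? := value_group_val fgE.
rewrite rmorphM /= [filt_alg_val _]val_homog ?fgE //.
rewrite [filt_alg_val (homog x f)]val_homog ?fE //.
rewrite [filt_alg_val (homog y g)]val_homog ?gE //.
apply/fsfunP => z; rewrite (@galg_mulE_sub _ _ _ _ _ [fset x]%fset) ?finsupp_sub //.
rewrite big_seq_fset1 !galg_monoE eqxx subr_eq [y + x]addrC.
by case: eqP => //; rewrite mulr0.
Qed.

(** Equality of initial forms, without the graded algebra. *)
Lemma init_form_eqP g h : mu g != Infty ->
  mu_equiv mu g h <-> mu g < mu (g - h).
Proof.
case gE: (mu g) => [x|] // _; have xG := value_group_val gE.
rewrite /mu_equiv (init_formE gE); split=> [|lt_gh].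
  case hE: (mu h) => [y|]; last first.
    rewrite (init_form_infty hE) -(init_formE gE) => /init_form_eq0.
    by rewrite gE.
  rewrite (init_formE hE) => /graded_pi_eq/(_ x).
  rewrite !val_homog ?gE ?hE //; last exact: value_group_val hE.
  rewrite !galg_monoE eqxx; case: eqP => // _; by rewrite subr0 gE ltxx.
have hE : mu h = Fin x by rewrite -gE; apply: valB_eq; rewrite gE.
rewrite (init_formE hE); apply/graded_pi_eq => y.
rewrite !val_homog ?gE ?hE // !galg_monoE; case: eqP => [->//|_].
by rewrite subr0 valuation0 ltx_infty.
Qed.

(** Divisibility of initial forms, without the graded algebra. *)
Lemma mu_dividesP h g : mu g != Infty ->
  mu_divides mu h g <-> exists c, mu g < mu (g - c * h).
Proof.
move=> g_fin; split=> [[c]|[c]]; last first.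
  by move/(init_form_eqP _ g_fin); rewrite /mu_equiv init_formM; exists (init_form mu c).
case gE: (mu g) g_fin => [x|] // _; have xG := value_group_val gE.
elim/quotW: c => a; rewrite -[\pi_({ideal_quot graded_ideal mu})%qT a]/(graded_pi a).
case hE: (mu h) => [y|]; last first.
  by rewrite (init_form_infty hE) mulr0 => /init_form_eq0; rewrite gE.
rewrite (init_formE gE) (init_formE hE) -rmorphM => /graded_pi_eq/(_ x).
rewrite rmorphM /= [filt_alg_val (homog x g)]val_homog ?gE //.
rewrite [filt_alg_val (homog y h)]val_homog ?hE //; last exact: value_group_val hE.
rewrite galg_monoE eqxx mulrC (@galg_mulE_sub _ _ _ _ _ [fset y]%fset) ?finsupp_sub //.
by rewrite big_seq_fset1 galg_monoE eqxx mulrC; exists (filt_alg_val a (x - y)).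
Qed.

(** Every element of the graded algebra is the sum of its homogeneous components. *)
Lemma filt_alg_sum a : a = \sum_(x <- finsupp (val a)) homog x (val a x).
Proof.
apply: val_inj; apply/fsfunP => y; rewrite raddf_sum /=.
transitivity (\sum_(x <- finsupp (val a)) (if y == x then val a x else 0)).
  case: (finsuppP (val a) y) => [yN|ya].
    rewrite big_seq big1 // => x xa; case: eqP => // e; by rewrite e xa in yN.
  by rewrite (big_fsetD1 y) //= eqxx big_seq big1 ?addr0 // => x;
    rewrite !inE eq_sym => /andP[/negbTE ->].
have E : forall (s : seq L) (F : L -> galg {poly K} L),
    (\sum_(x <- s) F x) y = \sum_(x <- s) (F x y).
  move=> s F; elim: s => [|z s IH]; first by rewrite !big_nil galg0E.
  by rewrite !big_cons galg_addE IH.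
rewrite E !big_seq; apply: eq_bigr => x; rewrite mem_finsupp => xa.
have [xh xG] := asboolP _ (valP a) x.
by rewrite [filt_alg_val (homog _ _)]val_homog ?galg_monoE //; exact: xG.
Qed.

End Graded.


(** * Key polynomials *)

Section KeyPolynomials.
Context (K : fieldType) (L : oagType) (mu : valuation {poly K} L).
Context (phi : {poly K}).
Implicit Types (f g q r : {poly K}).

Lemma mu_divides_mod f : mu f < mu (f %% phi) -> mu_divides mu phi f.
Proof.
move=> h; apply/mu_dividesP; first exact: lt_finite h.
by exists (f %/ phi); rewrite [X in mu (X - _)](divp_eq f phi) addrC addKr.
Qed.

(** A valuation above [mu] which is larger than [mu] at [phi] is so at every
    multiple of [phi]. *)
Lemma mu_divides_lt (nu : valuation {poly K} L) f :
  (forall g, mu g <= nu g) -> mu phi < nu phi -> mu f != Infty ->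
  mu_divides mu phi f -> mu f < nu f.
Proof.
move=> le_munu lt_phi f_fin /(mu_dividesP _ f_fin)[c fc].
have cphi : mu (c * phi) = mu f by apply: valB_eq.
rewrite -[f in nu f](subrK (c * phi)); apply: valD_gt.
  exact: lt_le_trans fc (le_munu _).
rewrite -cphi !valuationM addrC [nu c + _]addrC; apply: ext_ltD2 => //.
by move: f_fin; rewrite -cphi valuationM extD_infty negb_or => /andP[].
Qed.

Context (kp : KP mu phi).

Lemma KP_monic : phi \is monic. Proof. by case: kp. Qed.

Lemma KP_finite : mu phi != Infty.
Proof.
case: kp => _ _ [+ _ _]; apply: contraNneq => h.
by apply/eqP/init_form_eq0.
Qed.

Lemma KP_size : (1 < size phi)%N.
Proof.
rewrite ltnNge; apply/negP => size_phi.
have phi1 : phi = 1.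
  have := KP_monic; rewrite [phi]size1_polyC // monicE lead_coefC.
  by move/eqP=> ->.
case: kp => _ _ [_ [_ /negP one_notin _] _]; apply: one_notin; apply/asboolP; exists 1.
by rewrite phi1 init_form1 mulr1.
Qed.

Lemma KP_neq0 : phi != 0. Proof. exact: monic_neq0 KP_monic. Qed.

(** [mu]-minimality: [mu] is the minimum of its values on the two terms of a
    Euclidean division by [phi]. *)
Lemma KP_expand q r : (size r < size phi)%N ->
  mu (q * phi + r) = Order.min (mu r) (mu q + mu phi).
Proof.
move=> sr; rewrite -valuationM.
have [lt_r|lt_q|eq_rq] := ltgtP (mu r) (mu (q * phi)).
- by rewrite addrC valD_lt // (min_idPl _) // ltW.
- by rewrite valD_lt.
rewrite eq_rq; apply/le_anti/andP; split; last by apply: valD_ge; rewrite ?eq_rq.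
rewrite leNgt; apply/negP => h.
have r_fin : mu r != Infty by rewrite eq_rq; apply: lt_finite h.
case: kp => _ kpmin _; case: (kpmin r) => //.
  by apply: contraNneq r_fin => ->; rewrite valuation0.
by apply/mu_dividesP => //; exists (- q); rewrite mulNr opprK addrC eq_rq.
Qed.

(** [mu]-irreducibility: reduction modulo [phi] is multiplicative with respect
    to [mu] on the polynomials of degree less than [deg phi]. *)
Lemma KP_modM f g : (size f < size phi)%N -> (size g < size phi)%N ->
  mu ((f * g) %% phi) = mu f + mu g.
Proof.
move=> sf sg; have [->|f0] := eqVneq f 0; first by rewrite mul0r mod0p valuation0.
have [->|g0] := eqVneq g 0; first by rewrite mulr0 mod0p valuation0 extDy.
rewrite -valuationM; apply/le_anti/andP; split; last first.
  rewrite [X in mu X <= _](divp_eq (f * g) phi) KP_expand ?ltn_modp ?KP_neq0 //.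
  by rewrite ge_min lexx.
rewrite leNgt; apply/negP => /mu_divides_mod [c fgE].
case: kp => _ kpmin [_ _ /(_ (init_form mu f) (init_form mu g)) prime_phi].
have /prime_phi/orP[/asboolP div_f|/asboolP div_g] :
    init_form mu f * init_form mu g \in principal_ideal (init_form mu phi).
- by apply/asboolP; exists c; rewrite -init_formM.
- exact: (kpmin f).
- exact: (kpmin g).
Qed.

End KeyPolynomials.

(** * Augmentation along the expansion *)

Section Augmentation.
Context (K : fieldType) (L : oagType) (mu : valuation {poly K} L).
Context (phi : {poly K}) (gamma : ext L).
Implicit Types (f g q r : {poly K}).

(** The first [n] terms of the minimum defining the augmentation. *)
Fixpoint aug_rec n f : ext L :=
  if n is n'.+1 then
    Order.min (mu (f %% phi)) (gamma + aug_rec n' (f %/ phi))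
  else Infty.

(** The function [[mu; phi, gamma]]: the minimum over the terms of the
    [phi]-expansion, of which there are at most [size f] when [phi] is not
    constant. *)
Definition aug f : ext L := aug_rec (size f) f.

Context (size_phi : (1 < size phi)%N).

Lemma phi_neq0 : phi != 0.
Proof. by rewrite -size_poly_gt0 ltnW. Qed.
Let phi0 := phi_neq0.

Lemma size_div_phi f : f != 0 -> (size (f %/ phi)%R < size f)%N.
Proof.
by move=> f0; rewrite size_divp // ltn_subrL -subn1 subn_gt0 size_phi size_poly_gt0.
Qed.

(** Induction along [phi]-expansions. *)
Lemma phi_ind (P : {poly K} -> Prop) : P 0 ->
  (forall q r, (size r < size phi)%N -> P q -> P (q * phi + r)) ->
  forall f, P f.
Proof.
move=> P0 PS f; have [n] := ubnP (size f); elim: n f => // n IH f /ltnSE fn.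
have [->//|f0] := eqVneq f 0; rewrite (divp_eq f phi); apply: PS.
  by rewrite ltn_modp.
by apply: IH; apply: leq_trans (size_div_phi f0) fn.
Qed.

Lemma aug_rec0 n : aug_rec n 0 = Infty.
Proof.
elim: n => //= n IH.
by rewrite mod0p div0p IH valuation0 extDy minxx.
Qed.

Lemma aug_recE n f : (size f <= n)%N -> aug_rec n f = aug f.
Proof.
suff E m p : (size f <= m)%N -> (size f <= p)%N -> aug_rec m f = aug_rec p f.
  by move=> fn; apply: E.
elim: m p f => [|m IH] p f.
  by rewrite leqn0 size_poly_eq0 => /eqP -> _; rewrite !aug_rec0.
case: p => [|p].
  by move=> _; rewrite leqn0 size_poly_eq0 => /eqP ->; rewrite !aug_rec0.
have [->|f0] := eqVneq f 0; first by rewrite !aug_rec0.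
move=> fm fp /=; rewrite (IH p) //.
  exact: leq_trans (size_div_phi f0) fm.
exact: leq_trans (size_div_phi f0) fp.
Qed.

Lemma aug0 : aug 0 = Infty.
Proof. exact: aug_rec0. Qed.

Lemma augE f : aug f = Order.min (mu (f %% phi)) (gamma + aug (f %/ phi)).
Proof.
have [->|f0] := eqVneq f 0; first by rewrite mod0p div0p aug0 valuation0 extDy minxx.
have := size_div_phi f0; rewrite {1 2}/aug; case: (size f) => // n qn /=.
by rewrite (aug_recE qn).
Qed.

(** One step of the [phi]-expansion. *)
Lemma aug_expand q r : (size r < size phi)%N ->
  aug (q * phi + r) = Order.min (mu r) (gamma + aug q).
Proof.
by move=> sr; rewrite augE modp_addl_mul_small // divp_addl_mul_small.
Qed.

Lemma aug_small r : (size r < size phi)%N -> aug r = mu r.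
Proof.
move=> sr; rewrite -[r in LHS]add0r -(mul0r phi) aug_expand // aug0 extDy.
by rewrite (min_idPl _) // lex_infty.
Qed.

Lemma aug_mulphi f : aug (f * phi) = gamma + aug f.
Proof.
rewrite -[_ * _]addr0 aug_expand ?size_poly0 ?valuation0 1?ltnW //.
by rewrite (min_idPr _) // lex_infty.
Qed.

Lemma augN f : aug (- f) = aug f.
Proof.
elim/phi_ind: f => [|q r sr IH]; first by rewrite oppr0.
by rewrite opprD -mulNr !aug_expand ?size_polyN // IH valuationN.
Qed.

Lemma augD_ge c f g : c <= aug f -> c <= aug g -> c <= aug (f + g).
Proof.
move=> cf cg; have {cf cg} : c <= Order.min (aug f) (aug g) by rewrite le_min cf.
move=> /le_trans; apply.
elim/phi_ind: f g => [|q r sr IH] g; first by rewrite add0r aug0 ge_min lexx orbT.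
rewrite [X in _ <= aug X](_ : _ = (q + g %/ phi) * phi + (r + g %% phi)); last first.
  by rewrite {1}(divp_eq g phi) mulrDl addrACA.
rewrite !aug_expand // ?(augE g); last first.
  by apply: leq_ltn_trans (size_polyD _ _) _; rewrite gtn_max sr ltn_modp.
rewrite le_min; apply/andP; split.
  by apply: valD_ge; rewrite !ge_min lexx ?orbT.
apply: le_trans (ext_leD (lexx gamma) (IH _)).
by rewrite extD_minr le_min !ge_min !lexx !orbT.
Qed.

Lemma aug_sum n (a : nat -> {poly K}) :
  (forall s, (s < n)%N -> (size (a s) < size phi)%N) ->
  aug (\sum_(s < n) a s * phi ^+ s)
    = \big[Order.min/Infty]_(s < n) (mu (a s) + gamma *+ s).
Proof.
elim: n a => [|n IH] a sa; first by rewrite !big_ord0 aug0.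
rewrite !big_ord_recl /= expr0 mulr1 mulr0n addr0 addrC.
have -> : \sum_(i < n) a (bump 0 i) * phi ^+ bump 0 i
    = (\sum_(i < n) a i.+1 * phi ^+ i) * phi.
  by rewrite mulr_suml; apply: eq_bigr => i _; rewrite [bump 0 i]add1n exprSr mulrA.
rewrite aug_expand ?sa //.
under [X in _ = Order.min _ X]eq_bigr do rewrite mulrS addrCA.
rewrite /= -(big_morph _ (extD_minr gamma) (extDy gamma)) (IH (fun s => a s.+1)) //.
by move=> s sn; apply: sa.
Qed.

(** The augmentation lies below every valuation which is at least [gamma] at
    [phi] and at least [mu] at the polynomials of degree less than [deg phi]. *)
Lemma aug_le (nu : valuation {poly K} L) f :
  (forall r, (size r < size phi)%N -> mu r <= nu r) -> gamma <= nu phi ->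
  aug f <= nu f.
Proof.
move=> le_small le_phi; elim/phi_ind: f => [|q r sr IH].
  by rewrite valuation0 lex_infty.
rewrite aug_expand //; apply: valD_ge; last by rewrite ge_min le_small.
by rewrite valuationM ge_min addrC ext_leD ?orbT.
Qed.

End Augmentation.

(** * The augmented valuation *)

Section AugmentedValuation.
Context (K : fieldType) (L : oagType) (mu : valuation {poly K} L).
Context (phi : {poly K}) (gamma : ext L).
Context (kp : KP mu phi) (lt_phi : mu phi < gamma).
Implicit Types (f g q r : {poly K}).

Let size_phi := KP_size kp.
Local Notation nu := (aug mu phi gamma).

Lemma le_aug f : mu f <= nu f.
Proof.
elim/(phi_ind size_phi): f => [|q r sr IH]; first by rewrite aug0 lex_infty.
rewrite aug_expand // (KP_expand kp) // le_min !ge_min lexx /=.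
by rewrite addrC ext_leD ?orbT // ltW.
Qed.

Lemma augM_ge_small f g : (size f < size phi)%N -> mu f + nu g <= nu (f * g).
Proof.
move=> sf; elim/(phi_ind size_phi): g => [|q r sr IH].
  by rewrite mulr0 aug0 // lex_infty.
rewrite mulrDr mulrA aug_expand // extD_minr; apply: augD_ge => //.
  by rewrite aug_mulphi // ge_min addrCA (ext_leD (lexx _) IH) orbT.
by apply: le_trans (le_aug _); rewrite valuationM ge_min lexx.
Qed.

Lemma augM_ge f g : nu f + nu g <= nu (f * g).
Proof.
elim/(phi_ind size_phi): f => [|q r sr IH].
  by rewrite mul0r aug0 // lex_infty.
rewrite aug_expand // [_ + nu g]addrC extD_minr mulrDl mulrAC; apply: augD_ge => //.
  by rewrite aug_mulphi // ge_min addrCA [nu g + nu q]addrC (ext_leD (lexx _) IH) orbT.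
by apply: le_trans (augM_ge_small _ sr); rewrite ge_min addrC lexx.
Qed.

(** The induction step when the value of [f] comes from its quotient by [phi]:
    then [f %% phi * g] is too large to affect the value of [f * g]. *)
Lemma augM_le_step f g : nu f < mu (f %% phi) ->
  nu (f %/ phi * g) = nu (f %/ phi) + nu g -> nu (f * g) <= nu f + nu g.
Proof.
move=> lt_mod IH.
have [->|g_fin] := eqVneq (nu g) Infty; first by rewrite extDy lex_infty.
rewrite leNgt; apply/negP => lt_fg.
have sr : (size (f %% phi)%R < size phi)%N by rewrite ltn_modp (KP_neq0 kp).
have fE : nu f = gamma + nu (f %/ phi).
  by move: lt_mod; rewrite augE // gt_min ltxx /= => /ltW/min_idPr.
have lt_rg : nu f + nu g < nu (f %% phi * g).
  exact: lt_le_trans (ext_ltD2 lt_mod (lexx _) g_fin) (augM_ge_small _ sr).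
have : nu (f %/ phi * g * phi) = nu f + nu g by rewrite aug_mulphi // IH fE addrA.
have -> : f %/ phi * g * phi = f * g + - (f %% phi * g).
  by rewrite {2}(divp_eq f phi) mulrDl addrK mulrAC.
move=> E; have : exists2 c, nu f + nu g < c & c <= nu (f * g + - (f %% phi * g)).
  exists (Order.min (nu (f * g)) (nu (f %% phi * g))); first by rewrite lt_min lt_fg.
  by apply: augD_ge => //; rewrite ?augN // ge_min lexx ?orbT.
by case=> c; rewrite E => /lt_le_trans h /h; rewrite ltxx.
Qed.

Lemma augM f g : nu (f * g) = nu f + nu g.
Proof.
have [n] := ubnP (size f + size g); elim: n f g => // n IH f g /ltnSE fgn.
apply/le_anti/andP; split; last exact: augM_ge.
have [->|f0] := eqVneq f 0; first by rewrite aug0 // lex_infty.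
have [->|g0] := eqVneq g 0; first by rewrite aug0 // extDy lex_infty.
have small h : (size (h %% phi)%R < size phi)%N by rewrite ltn_modp (KP_neq0 kp).
have mod_ge h : nu h <= mu (h %% phi) by rewrite augE // ge_min lexx.
have [lt_f|ge_f] := ltP (nu f) (mu (f %% phi)).
  apply: augM_le_step => //; apply: IH; apply: leq_trans fgn.
  by rewrite ltn_add2r size_div_phi.
have [lt_g|ge_g] := ltP (nu g) (mu (g %% phi)).
  rewrite mulrC addrC; apply: augM_le_step => //; apply: IH; apply: leq_trans fgn.
  by rewrite addnC ltn_add2l size_div_phi.
(* Both values are attained at the remainders, whose product reduces modulo
   [phi] to the remainder of [f * g]. *)
apply: le_trans (mod_ge (f * g)) _.
rewrite -modp_mul mulrC -modp_mul (KP_modM kp) // addrC.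
by apply: ext_leD.
Qed.

Lemma aug1 : nu 1 = 0.
Proof. by rewrite aug_small // ?valuation1 // size_poly1. Qed.

Lemma augD f g : Order.min (nu f) (nu g) <= nu (f + g).
Proof. by apply: augD_ge => //; rewrite ge_min lexx ?orbT. Qed.

(** The augmented valuation [[mu; phi, gamma]] of a key polynomial [phi]. *)
Definition aug_valuation : valuation {poly K} L :=
  Valuation aug1 (aug0 mu phi gamma) augM augD.

Lemma aug_phi : nu phi = gamma.
Proof. by have := aug_mulphi mu gamma size_phi 1; rewrite mul1r aug1 addr0. Qed.

(** The augmentation is larger than [mu] exactly at the multiples of [phi];
    in particular the locus does not depend on [gamma]. *)
Lemma lt_augP f : mu f < nu f <-> mu f != Infty /\ mu_divides mu phi f.
Proof.
split=> [lt_f|[f_fin div_f]]; last first.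
  have lt_nu : mu phi < nu phi by rewrite aug_phi.
  exact: (mu_divides_lt (nu := aug_valuation) le_aug lt_nu).
split; first exact: lt_finite lt_f.
by apply: mu_divides_mod; apply: lt_le_trans lt_f _; rewrite augE // ge_min lexx.
Qed.

End AugmentedValuation.


(** * The locus where a larger valuation differs *)

Lemma oag_seq_min (L : oagType) (P : L -> Prop) (s : seq L) x :
  x \in s -> P x ->
  exists x0, [/\ x0 \in s, P x0 & forall y, y \in s -> P y -> x0 <= y].
Proof.
elim: s x => // z s IH x; rewrite inE => xs Px.
have [[y [ys Py]]|noP] := pselect (exists y, y \in s /\ P y); last first.
  have zP : P z.
    by case/orP: xs => [/eqP <- //|xs]; case: noP; exists x.
  exists z; split=> //; first exact: mem_head.
  by move=> y; rewrite inE => /orP[/eqP -> //|ys Py]; case: noP; exists y.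
have [x0 [x0s Px0 x0min]] := IH y ys Py.
have [[zP z0]|nz] := pselect (P z /\ z <= x0).
  exists z; split=> // [|t]; first exact: mem_head.
  by rewrite inE => /orP[/eqP -> //|ts Pt]; apply: le_trans z0 (x0min t ts Pt).
exists x0; split=> // [|t]; first by rewrite inE x0s orbT.
rewrite inE => /orP[/eqP ->|] Pt; last exact: x0min.
by case/orP: (oag_total x0 z) => // z0; case: nz.
Qed.

Section Raised.
Context (K : fieldType) (L : oagType) (mu nu : valuation {poly K} L).
Context (le_munu : forall f, mu f <= nu f).
Implicit Types (f g q r : {poly K}) (c : K).

Lemma val_infty f : mu f = Infty -> nu f = Infty.
Proof. by move=> fE; apply/le_anti; rewrite lex_infty -fE le_munu. Qed.

Lemma val_const_finite (w : valuation {poly K} L) c : c != 0 -> w c%:P != Infty.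
Proof.
move=> c0; have : w (c%:P * c^-1%:P) = 0 by rewrite -polyCM mulfV // valuation1.
by rewrite valuationM; case: (w c%:P).
Qed.

Lemma val_const c : nu c%:P = mu c%:P.
Proof.
have [->|c0] := eqVneq c 0; first by rewrite !valuation0.
apply/le_anti; rewrite le_munu andbT leNgt; apply/negP => lt_c.
have E (w : valuation {poly K} L) : w c%:P + w c^-1%:P = 0.
  by rewrite -valuationM -polyCM mulfV // valuation1.
have := ext_ltD2 lt_c (le_munu c^-1%:P) (val_const_finite mu (invr_neq0 c0)).
by rewrite !E ltxx.
Qed.

(** If [nu] is not [mu], there is a monic polynomial of minimal degree among
    those at which [nu] is larger than [mu]. *)
Lemma raised_min g : mu g < nu g -> exists phi,
  [/\ phi \is monic, mu phi < nu phi
    & forall r, (size r < size phi)%N -> nu r = mu r].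
Proof.
pose P n := `[< exists f, size f = n /\ mu f < nu f >].
move=> lt_g; have exP : exists n, P n by exists (size g); apply/asboolP; exists g.
have [n /asboolP[f [fn lt_f]] nmin] := ex_minnP exP.
have f0 : f != 0 by apply: contraTneq lt_f => ->; rewrite !valuation0 ltxx.
have lc0 : (lead_coef f)^-1 != 0 by rewrite invr_neq0 ?lead_coef_eq0.
exists ((lead_coef f)^-1 *: f); split.
- by rewrite monicE lead_coefZ mulVf ?lead_coef_eq0.
- rewrite -mul_polyC !valuationM val_const addrC [_ + nu f]addrC.
  by apply: ext_ltD2 => //; exact: val_const_finite.
- move=> r; rewrite size_scale // fn => rn; apply/le_anti.
  rewrite le_munu andbT leNgt; apply/negP => lt_r.
  suff /nmin : P (size r) by rewrite leqNgt rn.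
  by apply/asboolP; exists r.
Qed.

(** The support of [mu] is trivial as soon as [mu] is not maximal. *)
Lemma raised_finite g f : mu g < nu g -> f != 0 -> mu f != Infty.
Proof.
move=> lt_g f0; apply/eqP => fE.
pose P n := `[< exists h : {poly K}, [/\ size h = n, h != 0 & mu h = Infty] >].
have exP : exists n, P n by exists (size f); apply/asboolP; exists f.
have [n /asboolP[h [hn h0 hE]] nmin] := ex_minnP exP.
have hmin k : k != 0 -> mu k = Infty -> (n <= size k)%N.
  by move=> k0 kE; apply: nmin; apply/asboolP; exists k.
have dvd_finite d : d %| g -> mu d != Infty.
  move=> /dvdpP[q gE]; apply: contraTneq lt_g => dE.
  by rewrite gE valuationM dE extDy ltNge lex_infty.
(* By minimality of its degree, [h] is coprime to [g]. *)
have cop : coprimep g h.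
  apply/coprimepP => d dg /dvdpP[q hqd].
  have d0 : d != 0 by apply: contraNneq h0 => d0; rewrite hqd d0 mulr0.
  have q0 : q != 0 by apply: contraNneq h0 => q0; rewrite hqd q0 mul0r.
  have qE : mu q = Infty.
    apply/eqP; have /eqP := hE; rewrite hqd valuationM extD_infty => /orP[//|].
    by rewrite (negPf (dvd_finite d dg)).
  have := hmin q q0 qE; rewrite -hn hqd size_mul // => sz.
  rewrite -size_poly_eq1 eqn_leq size_poly_gt0 d0 andbT.
  have sq : (0 < size q)%N by rewrite size_poly_gt0.
  have sd : (0 < size d)%N by rewrite size_poly_gt0.
  move: sz; rewrite -(prednK sd) addnS /= -[X in (_ <= X)%N -> _]addn0.
  by rewrite leq_add2l leqn0 => /eqP ->.
have /Bezout_eq1_coprimepP[[u w] /= uw1] := cop.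
have ug (v : valuation {poly K} L) : v h = Infty -> v (u * g) = 0.
  move=> vh; have -> : u * g = 1 - w * h by rewrite -uw1 addrK.
  by rewrite -(valuation1 v) valD_lt // valuationN valuationM vh extDy valuation1.
have mu_ug := ug mu hE; have nu_ug := ug nu (val_infty hE).
have u_fin : mu u != Infty by move: mu_ug; rewrite valuationM; case: (mu u).
have := ext_ltD2 lt_g (le_munu u) u_fin.
by rewrite [mu g + _]addrC [nu g + _]addrC -!valuationM mu_ug nu_ug ltxx.
Qed.

Context (phi : {poly K}) (phi_monic : phi \is monic) (lt_phi : mu phi < nu phi).
Context (phi_min : forall r, (size r < size phi)%N -> nu r = mu r).

Let phi0 : phi != 0 := monic_neq0 phi_monic.
Let finite f : f != 0 -> mu f != Infty. Proof. exact: raised_finite lt_phi. Qed.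

(** In the locus, the value of the remainder modulo [phi] is strictly larger. *)
Lemma raised_mod f : mu f < nu f -> mu f < mu (f %% phi).
Proof.
move=> lt_f; rewrite ltNge; apply/negP => le_mod.
have nu_mod : nu (f %% phi) = mu (f %% phi) by rewrite phi_min // ltn_modp.
have lt_mod : nu (f %% phi) < nu f by rewrite nu_mod; apply: le_lt_trans lt_f.
pose q := f %/ phi * phi.
have qE : q = f - f %% phi by rewrite {1}(divp_eq f phi) addrK.
have nu_q : nu q = mu (f %% phi).
  by rewrite qE addrC valD_lt valuationN.
have q0 : f %/ phi != 0.
  apply: contraTneq lt_mod => q0; rewrite -leNgt [X in nu X <= _](divp_eq f phi).
  by rewrite q0 mul0r add0r.
have lt_q : mu q < mu (f %% phi).
  rewrite -nu_q !valuationM addrC [nu (f %/ phi) + _]addrC.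
  exact: ext_ltD2 (le_munu _) (finite q0).
have fE : mu f = mu q by rewrite [X in mu X = _](divp_eq f phi) valD_lt.
by move: lt_q; rewrite -fE ltNge le_mod.
Qed.

Lemma raisedP f : mu f < nu f <-> mu f != Infty /\ mu_divides mu phi f.
Proof.
split=> [lt_f|[f_fin div_f]]; last exact: mu_divides_lt div_f.
by split; [exact: lt_finite lt_f | apply: mu_divides_mod; exact: raised_mod].
Qed.

(** The ideal generated by the initial form of [phi] is the kernel of the
    natural map from the graded algebra of [mu] to the one of [nu]. *)
Lemma principal_idealP (a : filt_alg mu) :
  graded_pi a \in principal_ideal (init_form mu phi) <->
  forall x, Fin x < nu (val a x).
Proof.
case phiE: (mu phi) (lt_finite lt_phi) => [y|] // _.
split=> [/asboolP[c] + x|h].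
  elim/quotW: c => b; rewrite -[\pi_({ideal_quot graded_ideal mu})%qT b]/(graded_pi b).
  rewrite (init_formE phiE) -rmorphM => /graded_pi_eq/(_ x).
  rewrite rmorphM /= [filt_alg_val (homog _ _ _)]val_homog ?phiE //;
    last exact: value_group_val phiE.
  rewrite mulrC (@galg_mulE_sub _ _ _ _ _ [fset y]%fset) ?finsupp_sub //.
  rewrite big_seq_fset1 galg_monoE eqxx => lt_ab.
  rewrite -[filt_alg_val a x](subrK (phi * filt_alg_val b (x - y))).
  apply: valD_gt; first exact: lt_le_trans lt_ab (le_munu _).
  have -> : Fin x = Fin (y + (x - y)) by rewrite addrC subrK.
  rewrite valuationM; apply: ext_ltD; first by rewrite -phiE.
  apply: le_trans (le_munu _).
  by case: (asboolP _ (valP b) (x - y)).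
rewrite (filt_alg_sum a) rmorph_sum /=; apply/asboolP.
have [F FE] : exists F : L -> graded_alg mu, forall x, x \in finsupp (val a) ->
    graded_pi (homog mu x (val a x)) = F x * init_form mu phi.
  suff /choice[F FE] : forall x, exists c : graded_alg mu, x \in finsupp (val a) ->
      graded_pi (homog mu x (val a x)) = c * init_form mu phi by exists F.
  move=> x; have [ax xG] := asboolP _ (valP a) x.
  have [xa|_] := boolP (x \in finsupp (val a)); last by exists 0.
  rewrite graded_pi_homog //; last by apply: xG; rewrite -mem_finsupp.
  case: eqP => [axE|_]; last by exists 0; rewrite mul0r.
  have lt_ax : mu (val a x) < nu (val a x) by rewrite axE.
  by have [_ [c ->]] := (raisedP _).1 lt_ax; exists c.
exists (\sum_(x <- finsupp (val a)) F x).
by rewrite mulr_suml !big_seq; apply: eq_bigr => x; exact: FE.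
Qed.

Lemma raised_min_irreducible : mu_irreducible mu phi.
Proof.
have pi_quot (u : graded_alg mu) : exists a, u = graded_pi a.
  by elim/quotW: u => a; exists a.
split.
- by apply/eqP => /init_form_eq0/eqP; rewrite (negPf (lt_finite lt_phi)).
- split=> [||c u w /asboolP[c1 ->] /asboolP[c2 ->]].
  + by apply/asboolP; exists 0; rewrite mul0r.
  + apply/negP; rewrite -(rmorph1 (@graded_pi _ _ mu)) => /principal_idealP/(_ 0).
    rewrite (_ : \val (1 : filt_alg mu) = 1) //.
    by rewrite galg_monoE eqxx valuation1 ltxx.
  + by apply/asboolP; exists (c * c1 + c2); rewrite mulrDl mulrA.
move=> u w; have [a ->] := pi_quot u; have [b ->] := pi_quot w.
rewrite -rmorphM => /principal_idealP prod_in.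
have [/principal_idealP ->//|a_notin] :=
  pselect (forall x, Fin x < nu (val a x)).
have [/principal_idealP ->|b_notin] :=
  pselect (forall x, Fin x < nu (val b x)); first by rewrite orbT.
(* The lowest homogeneous components of [a] and [b] outside the ideal have
   their product outside the ideal. *)
have lowest (d : filt_alg mu) : ~ (forall x, Fin x < nu (val d x)) ->
    exists x0, [/\ x0 \in finsupp (val d), nu (val d x0) = Fin x0
      & forall y, ~ Fin y < nu (val d y) -> x0 <= y].
  move=> /existsNP[x xN].
  have inS y : ~ Fin y < nu (val d y) -> y \in finsupp (val d).
    move=> yN; rewrite mem_finsupp; apply/eqP => dy0; case: yN.
    by rewrite [filt_alg_val d y]dy0 valuation0.
  have [x0 [x0S x0N x0min]] :=
    @oag_seq_min _ (fun y => ~ Fin y < nu (val d y)) _ _ (inS x xN) xN.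
  exists x0; split=> // [|y yN]; last exact: x0min (inS y yN) yN.
  apply/le_anti; rewrite leNgt (introN idP x0N) /=.
  by apply: le_trans (le_munu _); case: (asboolP _ (valP d) x0).
have [al [alS alE almin]] := lowest a a_notin.
have [be [beS beE bemin]] := lowest b b_notin.
have := prod_in (al + be); rewrite rmorphM /= galg_mulE (big_fsetD1 al) //=.
rewrite addrAC subrr add0r.
rewrite valD_lt valuationM [filt_alg_val a al]/= alE beE ext_addE ?ltxx //.
rewrite big_seq; apply: (big_ind (fun f => Fin (al + be) < nu f)).
- by rewrite valuation0 ltx_infty.
- by move=> f g; exact: valD_gt.
move=> x; rewrite !inE => /andP[xal _]; rewrite valuationM.
have -> : Fin (al + be) = Fin (x + (al + be - x)) by rewrite [x + _]addrC subrK.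
have [ax _] := asboolP _ (valP a) x.
have [bx _] := asboolP _ (valP b) (al + be - x).
have [lt_x|/almin le_x] := pselect (Fin x < nu (val a x)).
  by apply: ext_ltD => //; exact: le_trans bx (le_munu _).
rewrite [x + _]addrC [X in _ < X]addrC; apply: ext_ltD;
  last exact: le_trans ax (le_munu _).
apply: contrapT => /bemin/(oag_leD2l (x - be)).
have -> : x - be + (al + be - x) = al by rewrite addrC addrA subrK addrK.
by rewrite subrK => le_xal; move/eqP: xal; apply; apply/le_anti; rewrite le_x le_xal.
Qed.

Lemma raised_min_minimal : mu_minimal mu phi.
Proof.
move=> f f0 sf div_f; have := phi_min sf.
have /raisedP lt_f := conj (finite f0) div_f.
by move=> e; move: lt_f; rewrite e ltxx.
Qed.

Lemma raised_min_KP : KP mu phi.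
Proof. split=> //; [exact: raised_min_minimal | exact: raised_min_irreducible]. Qed.

End Raised.

(** * Invariance of the locus *)

Section SameLocus.
Context (K : fieldType) (L : oagType) (mu : valuation {poly K} L).
Implicit Types (phi psi f : {poly K}).

Lemma mu_divides_refl phi : mu_divides mu phi phi.
Proof. by exists 1; rewrite mul1r. Qed.

Lemma monic_size_sub phi psi : phi \is monic -> psi \is monic ->
  size phi = size psi -> (size (psi - phi)%R < size phi)%N.
Proof.
move=> /monicP m1 /monicP m2 sE; have phi0 : phi != 0.
  by apply/eqP => p0; have := m1; rewrite p0 lead_coef0 => /eqP; rewrite eq_sym oner_eq0.
rewrite (polySpred phi0) ltnS; apply/leq_sizeP => j.
rewrite leq_eqVlt -polySpred // coefB => /orP[/eqP <-|le_j].
  by rewrite {1}sE -!lead_coefE m1 m2 subrr.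
by rewrite !nth_default ?subrr // -sE.
Qed.

(** Two key polynomials whose initial forms divide each other have the same
    degree; being monic, they are [mu]-equivalent. *)
Lemma KP_mutual_equiv phi psi : KP mu phi -> KP mu psi ->
  mu_divides mu phi psi -> mu_divides mu psi phi -> mu_equiv mu phi psi.
Proof.
move=> kphi kpsi div1 div2.
have sz : size phi = size psi.
  apply/eqP; rewrite eqn_leq; apply/andP; split; rewrite leqNgt; apply/negP => lt_s.
    by case: kphi => _ kpmin _; exact: (kpmin psi (KP_neq0 kpsi) lt_s div1).
  by case: kpsi => _ kpmin _; exact: (kpmin phi (KP_neq0 kphi) lt_s div2).
have lt_phi : mu phi < Infty by rewrite ltx_infty (KP_finite kphi).
have lt_psi := (lt_augP kphi lt_phi psi).2 (conj (KP_finite kpsi) div1).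
apply/esym/init_form_eqP; first exact: KP_finite.
apply: lt_le_trans lt_psi _.
have sub := monic_size_sub (KP_monic kphi) (KP_monic kpsi) sz.
have psiE : psi = 1 * phi + (psi - phi) by rewrite mul1r addrC subrK.
rewrite [X in aug _ _ _ X <= _]psiE aug_expand ?ge_min ?lexx //.
exact: KP_size kphi.
Qed.

Context (rho nu : valuation {poly K} L).
Context (le_murho : forall f, mu f <= rho f) (le_rhonu : forall f, rho f <= nu f).

(** The locus where [nu] is larger than [mu] depends only on the tangent
    direction of [nu]: it does not change when [nu] is replaced by a valuation
    strictly above [mu] and at most [nu]. *)
Lemma raised_between g f : mu g < rho g -> (mu f < rho f <-> mu f < nu f).
Proof.
move=> lt_g; split=> [lt_f|]; first exact: lt_le_trans lt_f (le_rhonu f).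
have le_munu h : mu h <= nu h := le_trans (le_murho h) (le_rhonu h).
have [phi [phi_monic lt_phi phi_min]] := raised_min le_murho lt_g.
have kphi := raised_min_KP le_murho phi_monic lt_phi phi_min.
have phi_fin := KP_finite kphi.
have lt_phi_nu := lt_le_trans lt_phi (le_rhonu phi).
have [psi [psi_monic lt_psi psi_min]] := raised_min le_munu lt_phi_nu.
have raisedE := raisedP le_munu psi_monic lt_psi psi_min.
have [_ div_phi] := (raisedE phi).1 lt_phi_nu.
suff lt_psi_rho : mu psi < rho psi.
  by move=> /raisedE[f_fin]; exact: (mu_divides_lt le_murho lt_psi_rho).
apply/(raisedP le_murho phi_monic lt_phi phi_min).
split; first exact: lt_finite lt_psi.
(* [psi] divides [phi], which is prime: otherwise [phi] would divide the
   cofactor, and [psi] would divide [1]. *)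
have [c phiE] := (mu_dividesP _ phi_fin).1 div_phi.
have c_fin : mu c != Infty.
  by have := phi_fin; rewrite -(valB_eq phiE) valuationM extD_infty negb_or => /andP[].
have initE : init_form mu phi = init_form mu c * init_form mu psi.
  by rewrite -init_formM; exact: (init_form_eqP _ phi_fin).2.
case: (kphi) => _ _ [_ _ /(_ (init_form mu c) (init_form mu psi))].
case/(_ _)/orP => [|/asboolP /(mu_dividesP _ c_fin)[d cE]|/asboolP //].
  by apply/asboolP; exists 1; rewrite mul1r.
have mul_lt : mu phi < mu (phi * (1 - d * psi)).
  have -> : phi * (1 - d * psi) = (phi - c * psi) + (c - d * phi) * psi.
    rewrite mulrBr mulr1 mulrBl addrA subrK; congr (_ - _).
    by rewrite mulrCA mulrA.
  apply: valD_gt => //; rewrite valuationM -(valB_eq phiE) valuationM.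
  by apply: ext_ltD2 => //; exact: lt_finite lt_psi.
have div1 : mu_divides mu psi 1.
  apply/mu_dividesP; rewrite valuation1 //; exists d; rewrite ltNge.
  apply/negP => le0; move: mul_lt; rewrite valuationM ltNge => /negP; apply.
  by rewrite -[X in _ <= X]addr0 ext_leD.
have := (raisedE 1).2; rewrite !valuation1 ltxx => absurd.
by have := absurd (conj isT div1).
Qed.

End SameLocus.

(** * Tangent directions *)

Section TangentDirections.
Context (K : fieldType) (Gamma Lambda : oagType).
Context (v : valuation K Gamma) (iota : Gamma -> Lambda).
Implicit Types (mu nu rho : node v iota) (phi psi f : {poly K}).

Lemma node_leP mu nu : reflect (forall f, mu f <= nu f) (mu <= nu)%O.
Proof. exact: asboolP. Qed.

Lemma node_ltP mu nu :
  (mu < nu)%O <-> (forall f, mu f <= nu f) /\ exists g, mu g < nu g.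
Proof.
rewrite lt_neqAle; split=> [/andP[/eqP ne /node_leP le_munu]|[le_munu [g lt_g]]].
  split=> //; apply: contrapT => /forallNP no_lt; apply: ne; apply: node_eqP => f.
  by apply/le_anti; rewrite le_munu leNgt; apply/negP/no_lt.
apply/andP; split; last exact/node_leP.
by apply: contraTneq lt_g => ->; rewrite ltxx.
Qed.

Lemma aug_res mu phi gamma (kp : KP mu phi) (lt_phi : mu phi < gamma) c :
  aug_valuation kp lt_phi c%:P = ext_map iota (v c).
Proof.
rewrite -(node_res mu) /= aug_small ?(KP_size kp) //.
by apply: leq_ltn_trans (size_polyC_leq1 c) (KP_size kp).
Qed.

(** The augmented valuation as a node of the tree. *)
Definition aug_node mu phi gamma (kp : KP mu phi) (lt_phi : mu phi < gamma) :
  node v iota := Node (aug_res kp lt_phi).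

Section Fixed.
Context (mu : node v iota).

Lemma aug_node_lt phi gamma (kp : KP mu phi) (lt_phi : mu phi < gamma) :
  (mu < aug_node kp lt_phi)%O.
Proof.
apply/node_ltP; split; first exact: le_aug.
exists phi; suff : mu phi < aug mu phi gamma phi by [].
by rewrite aug_phi.
Qed.

Lemma aug_nodeP phi gamma (kp : KP mu phi) (lt_phi : mu phi < gamma) :
  is_augmentation mu phi gamma (aug_node kp lt_phi).
Proof. by move=> n a; apply: aug_sum; exact: KP_size kp. Qed.

(** Two nodes above [mu] are tangent exactly if they are larger than [mu] at
    the same polynomials. *)
Lemma tan_equivP nu nu' : (mu < nu)%O -> (mu < nu')%O ->
  tan_equiv mu nu nu' <-> (forall f, mu f < nu f <-> mu f < nu' f).
Proof.
move=> /node_ltP[le_nu [g lt_g]] /node_ltP[le_nu' _]; split=> [|same].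
  move=> [rho [/andP[/node_ltP[le_rho [h lt_h]] /node_leP le1] /andP[_ /node_leP le2]]] f.
  have := raised_between le_rho le1 f lt_h.
  by have := raised_between le_rho le2 f lt_h; tauto.
have [phi [phi_monic lt_phi phi_min]] := raised_min le_nu lt_g.
have kphi := raised_min_KP le_nu phi_monic lt_phi phi_min.
have lt_min : mu phi < Order.min (nu phi) (nu' phi).
  by rewrite lt_min lt_phi; apply/same.
have aug_below nu0 : (forall f, mu f <= nu0 f) ->
    Order.min (nu phi) (nu' phi) <= nu0 phi -> (aug_node kphi lt_min <= nu0)%O.
  move=> le_nu0 le_phi; apply/node_leP => f.
  exact: (aug_le (KP_size kphi)).
exists (aug_node kphi lt_min).
by split; apply/andP; split; rewrite ?aug_node_lt // aug_below // ge_min lexx ?orbT.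
Qed.

(** The tangent direction of a key polynomial [phi]: the nodes which are larger
    than [mu] exactly at the multiples of [phi]. *)
Definition tangent phi : set (node v iota) :=
  [set nu | (mu < nu)%O /\
    forall f, mu f < nu f <-> mu f != Infty /\ mu_divides mu phi f].

Lemma tangent_class phi nu : tangent phi nu -> tangent phi = tan_class mu nu.
Proof.
move=> [lt_nu nuE]; apply/seteqP; split=> nu' [lt_nu' h]; split=> //.
  by apply/tan_equivP => // f; rewrite nuE h.
by move=> f; rewrite -nuE; apply: iff_sym; exact: (tan_equivP lt_nu lt_nu').1.
Qed.

Lemma tangent_aug phi gamma (kp : KP mu phi) (lt_phi : mu phi < gamma) :
  tangent phi (aug_node kp lt_phi).
Proof. by split; [exact: aug_node_lt | exact: lt_augP]. Qed.

Lemma lt_phi_infty phi : KP mu phi -> mu phi < Infty.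
Proof. by move=> kp; rewrite ltx_infty KP_finite. Qed.

Lemma tangent_TD phi : KP mu phi -> TD mu (tangent phi).
Proof.
move=> kp; exists (aug_node kp (lt_phi_infty kp)); first exact: aug_node_lt.
by apply/esym/tangent_class; exact: tangent_aug.
Qed.

Lemma TD_tangent t : TD mu t -> exists2 phi, KP mu phi & tangent phi = t.
Proof.
move=> [nu lt_nu <-]; have /node_ltP[le_nu [g lt_g]] := lt_nu.
have [phi [phi_monic lt_phi phi_min]] := raised_min le_nu lt_g.
exists phi; first exact: raised_min_KP lt_phi phi_min.
by apply: tangent_class; split=> //; exact: raisedP.
Qed.

Lemma tangent_equiv phi psi : KP mu phi -> KP mu psi ->
  tangent phi = tangent psi <-> mu_equiv mu phi psi.
Proof.
move=> kphi kpsi; split=> [E|E]; last by rewrite /tangent /mu_divides E.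
have nu_phi := tangent_aug kphi (lt_phi_infty kphi).
have nu_psi := nu_phi; rewrite E in nu_psi.
case: nu_phi nu_psi => _ phiE [_ psiE].
apply: KP_mutual_equiv => //.
  apply: ((phiE psi).1 _).2; apply/psiE.
  by split; [exact: KP_finite | exact: mu_divides_refl].
apply: ((psiE phi).1 _).2; apply/phiE.
by split; [exact: KP_finite | exact: mu_divides_refl].
Qed.

Lemma KP_class_equiv phi psi : mu_equiv mu phi psi -> KP_class mu phi = KP_class mu psi.
Proof. by move=> E; rewrite /KP_class /mu_equiv E. Qed.

End Fixed.
End TangentDirections.

Theorem proposition2p4 (K : fieldType) (Gamma Lambda : oagType)
    (v : valuation K Gamma)
    (v_surj : forall alpha : Gamma, exists c : K, v c = Fin alpha)
    (iota : {additive Gamma -> Lambda})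
    (iota_mono : {mono iota : x y / x <= y})
    (mu : node v iota) (mu_inner : inner_node mu) :
  exists t : {poly K} -> set (node v iota),
    [/\ forall phi gamma, KP mu phi -> mu phi < gamma ->
          exists nu, [/\ is_augmentation mu phi gamma nu, (mu < nu)%O
                       & t phi = tan_class mu nu],
        set_fun (KP mu) (TD mu) t
      & exists tbar : set {poly K} -> set (node v iota),
          (forall phi, KP mu phi -> tbar (KP_class mu phi) = t phi) /\
          set_bij (KP_quotient mu) (TD mu) tbar].
Proof.
exists (tangent mu); split; last 2 first.
- by move=> phi; exact: tangent_TD.
- pose tbar (S : set {poly K}) := \bigcup_(phi in S) tangent mu phi.
  have tbarE phi : KP mu phi -> tbar (KP_class mu phi) = tangent mu phi.
    move=> kphi; apply/seteqP; split=> [nu [psi [kpsi]]|nu nu_phi].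
      by move=> /(tangent_equiv kphi kpsi) ->.
    by exists phi.
  exists tbar; split=> //; split.
  + by move=> _ [phi kphi <-]; rewrite tbarE //; exact: tangent_TD.
  + move=> _ _ /set_mem[phi kphi <-] /set_mem[psi kpsi <-].
    by rewrite !tbarE // => /(tangent_equiv kphi kpsi)/KP_class_equiv.
  + move=> t /TD_tangent[phi kphi <-].
    by exists (KP_class mu phi); [exists phi | exact: tbarE].
move=> phi gamma kphi lt_phi; exists (aug_node kphi lt_phi); split.
- exact: aug_nodeP.
- exact: aug_node_lt.
- by apply: tangent_class; exact: tangent_aug.
Qed.
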